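(* Let $n\in\mathbb{N}$ be a multiple of $4$, let $T=\{x\in\{0,1\}^n : |x|=n/2\}$ be the half slice, and let $f:T\to\{0,1\}$ be such that \[ \Pr_{x,y\sim\{0,1\}^n}\bigl[f(x+y)=f(x)+f(y)\;\big|\;x,y,x+y\in T\bigr]=\frac{1+\delta}{2}. \] Then there exists $u\in\{0,1\}^n$ such that \[ \Pr_{x\sim\{0,1\}^n}\bigl[f(x)=x\cdot u\;\big|\;x\in T\bigr]\;\geq\;\frac{1+\delta}{2}-o(1). \]
   Context: $|x|$ denotes the Hamming weight of $x\in\{0,1\}^n$; addition of vectors and the value $f(x)+f(y)$ are taken modulo $2$; $x\cdot u=\sum_i x_iu_i \bmod 2$. In the probability, $x,y$ are uniform in $\{0,1\}^n$ conditioned on the event $x,y,x+y\in T$. The term $o(1)$ denotes a quantity depending only on $n$ (not on $f$) that tends to $0$ as $n\to\infty$. *)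

(* Defs.v *)
From HB Require Import structures.
From mathcomp Require Import all_boot all_order all_algebra.
From mathcomp Require Import reals.

Set Implicit Arguments.
Unset Strict Implicit.
Unset Printing Implicit Defensive.

Import GRing.Theory.
Local Open Scope ring_scope.

Definition hweight (n : nat) (x : 'rV['F_2]_n) : nat :=
  #|[pred i : 'I_n | x 0 i != 0]|.

Definition half_slice (n : nat) : {set 'rV['F_2]_n} :=
  [set x | hweight x == n./2].

Definition dotv (n : nat) (x u : 'rV['F_2]_n) : 'F_2 :=
  \sum_(i < n) x 0 i * u 0 i.

Definition uprob (R : realType) (Omega : finType) (A : pred Omega) : R :=
  #|A|%:R / #|Omega|%:R.

(* Conditioning on an empty event gives 0, as division by 0 does. *)
Definition ucprob (R : realType) (Omega : finType) (A B : pred Omega) : R :=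
  uprob R (predI A B) / uprob R B.

(* Main.v *)
(* For A a subset of F_2^n and F : A -> {1, -1}, let hat(u) = E_{x in A} F(x) chi_u(x) and
   mu(u) = E_{x in A} chi_u(x), put K = 2^n / |A|, and let W be the set of the u whose character
   chi_u is trivial on A.  As on the whole cube, sum_u hat(u)^3 = (sum_u mu(u)^3) delta, where
   delta is the bias of the additivity test.  If |mu| <= b off W, Parseval gives
   sum_u mu(u)^3 >= |W| - b K.

   For an upper bound, Parseval (sum_u hat(u)^2 = K) is too weak, since K has order sqrt n on the
   half slice.  Instead, let p be the positive part of hat and P = sum_u p(u)^3.  By
   Cauchy-Schwarz on A,
     P^2 = (E_{x in A} F(x) sum_u p(u)^2 chi_u(x))^2 <= sum_{u,v} p(u)^2 p(v)^2 mu(u + v).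
   As hat is W-invariant, the pairs with u + v in W contribute at most |W| (max hat) P; if
   mu <= r^2 off W, the other pairs contribute at most (r K)^2.  Hence P <= |W| max hat + r K
   and max hat >= delta - (b + r) K.

   The half slice has W = {0, 1}.  There mu vanishes at odd weights, equals -1/(n-1) at weights
   2 and n - 2, and is at most 3/((n-1)(n-3)) in absolute value elsewhere off W, so b and r are
   O(1/n) and the error is O(n^(-1/2)).  It is essential that the values -1/(n-1) are negative:
   a bound r^2 of order 1/n would leave an error of constant order. *)

Require Import Defs.
From HB Require Import structures.
From mathcomp Require Import all_boot all_order all_algebra all_fingroup.
From mathcomp Require Import reals topology normedtype sequences realfun.
From mathcomp Require Import ring lra zify.

Set Implicit Arguments.
Unset Strict Implicit.
Unset Printing Implicit Defensive.

Import Order.TTheory GRing.Theory Num.Theory.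
Import numFieldNormedType.Exports.
Local Open Scope classical_set_scope.
Local Open Scope ring_scope.

Section Mean.
Variables (R : realFieldType) (I : finType).
Implicit Types (A : {pred I}) (f g : I -> R).

Definition mean A g : R := (\sum_(x in A) g x) / #|A|%:R.

Lemma eq_mean A f g : {in A, f =1 g} -> mean A f = mean A g.
Proof. by move=> fg; congr (_ / _); apply: eq_bigr. Qed.

Lemma meanD A f g : mean A (fun x => f x + g x) = mean A f + mean A g.
Proof. by rewrite /mean big_split mulrDl. Qed.

Lemma meanZ A c g : mean A (fun x => c * g x) = c * mean A g.
Proof. by rewrite /mean -mulr_sumr mulrA. Qed.

Lemma sum_mean (J : finType) A (g : J -> I -> R) :
  \sum_j mean A (g j) = mean A (fun x => \sum_j g j x).
Proof. by rewrite -mulr_suml exchange_big. Qed.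

Lemma mean_cst A c : (0 < #|A|)%N -> mean A (fun=> c) = c.
Proof.
by move=> A_gt0; rewrite /mean sumr_const -[c *+ _]mulr_natr mulfK // pnatr_eq0 -lt0n.
Qed.

Lemma mean_empty A g : #|A| = 0%N -> mean A g = 0.
Proof. by rewrite /mean => ->; rewrite invr0 mulr0. Qed.

Lemma card_mul_mean A g : #|A|%:R * mean A g = \sum_(x in A) g x.
Proof.
have [A0|A_neq0] := eqVneq #|A| 0%N; last by rewrite mulrC mulfVK ?pnatr_eq0.
by rewrite A0 mul0r big_pred0 // => x; exact: card0_eq.
Qed.

Lemma mean_ge0 A g : {in A, forall x, 0 <= g x} -> 0 <= mean A g.
Proof. by move=> g0; rewrite divr_ge0 // sumr_ge0. Qed.

Lemma normr_mean_le1 A g : {in A, forall x, `|g x| <= 1} -> `|mean A g| <= 1.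
Proof.
move=> g1; have [A0|A_gt0] := posnP #|A|; first by rewrite mean_empty // normr0.
rewrite normrM normfV normr_nat ler_pdivrMr ?ltr0n // mul1r.
by apply: le_trans (ler_norm_sum _ _ _) _; rewrite -sumr_const; apply: ler_sum.
Qed.

Lemma sqr_mean_le A g : mean A g ^+ 2 <= mean A (fun x => g x ^+ 2).
Proof.
have [A0|A_gt0] := posnP #|A|; first by rewrite !mean_empty // expr0n.
set m := mean A g; rewrite -subr_ge0.
suff -> : mean A (fun x => g x ^+ 2) - m ^+ 2 = mean A (fun x => (g x - m) ^+ 2).
  by apply: mean_ge0 => x _; exact: sqr_ge0.
transitivity (mean A (fun x => g x ^+ 2 + (- 2 * m * g x + m ^+ 2))).
  by rewrite !meanD meanZ mean_cst // -/m; ring.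
by apply: eq_mean => x _; ring.
Qed.

End Mean.

Lemma ucprobE (R : realType) (I : finType) (P B : pred I) :
  ucprob R P B = mean B (fun x => (P x)%:R).
Proof.
have -> : mean B (fun x => (P x)%:R) = #|predI P B|%:R / #|B|%:R :> R.
  rewrite -[#|predI P B|]sum1_card natr_sum; congr (_ / _); rewrite big_mkcond [RHS]big_mkcond /=.
  by apply: eq_bigr => x _; rewrite !unfold_in /=; case: (P x); case: (B x).
rewrite /ucprob /uprob.
have [B0|B_gt0] := posnP #|B|; first by rewrite B0 mul0r invr0 !mulr0.
have I_gt0 : (0 < #|I|)%N := leq_trans B_gt0 (max_card B).
by field; rewrite !pnatr_eq0 -!lt0n I_gt0 B_gt0.
Qed.

Section F2.
Implicit Types a b : 'F_2.

Lemma F2_val_neq0 a : a = (a != 0) :> nat.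
Proof. by case: a => [[|[|m]] lt_m2]. Qed.

Lemma F2_neq0_eq1 a : a != 0 -> a = 1.
Proof. by move=> a0; apply/val_inj; rewrite /= F2_val_neq0 a0. Qed.

Lemma F2_row_oppr n (x : 'rV['F_2]_n) : - x = x.
Proof. by apply/rowP => i; rewrite mxE oppr_pchar2 ?pchar_Fp. Qed.

Lemma F2_row_addrr n (x : 'rV['F_2]_n) : x + x = 0.
Proof. by rewrite -{2}[x]F2_row_oppr subrr. Qed.

Lemma F2_row_addrK n (y : 'rV['F_2]_n) : involutive (+%R^~ y).
Proof. by move=> x; rewrite -addrA F2_row_addrr addr0. Qed.

Lemma F2_row_add_eq0 n (x y : 'rV['F_2]_n) : (x + y == 0) = (x == y).
Proof. by rewrite addr_eq0 F2_row_oppr. Qed.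

Section Sign.
Variable R : realFieldType.

Definition F2_sign a : R := (-1) ^+ a.

Lemma F2_sign1 : F2_sign 1 = -1.
Proof. by []. Qed.

Lemma F2_signD a b : F2_sign (a + b) = F2_sign a * F2_sign b.
Proof. by rewrite /F2_sign /= modn2 signr_odd exprD. Qed.

Lemma F2_sign_nat k : F2_sign k%:R = (-1) ^+ k.
Proof. by rewrite /F2_sign val_Fp_nat // modn2 signr_odd. Qed.

Lemma F2_sign_sqr a : F2_sign a ^+ 2 = 1.
Proof. exact: sqrr_sign. Qed.

Lemma natr_F2_eq a b : (a == b)%:R = (1 + F2_sign a * F2_sign b) / 2 :> R.
Proof.
by rewrite /F2_sign; case: a b => [[|[|//]] ?] [[|[|//]] ?]; rewrite -val_eqE /=; field.
Qed.

End Sign.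
End F2.

Lemma ucprob_F2_eq (R : realType) (I : finType) (f g : I -> 'F_2) (B : pred I) :
  ucprob R (fun x => f x == g x) B =
  ((0 < #|B|)%N%:R + mean B (fun x => F2_sign R (f x) * F2_sign R (g x))) / 2.
Proof.
rewrite ucprobE; have [B0|B_gt0] := posnP #|B|; first by rewrite !mean_empty // add0r mul0r.
transitivity (mean B (fun x => 2^-1 * (1 + F2_sign R (f x) * F2_sign R (g x)))).
  by apply: eq_mean => x _; rewrite natr_F2_eq mulrC.
by rewrite meanZ meanD mean_cst // mulrC.
Qed.

Local Notation "''e_' i" := (delta_mx 0 i : 'rV['F_2]_ _)
  (at level 8, i at level 2, format "''e_' i").
Local Notation ones := (const_mx 1 : 'rV['F_2]_ _).

Section HammingWeight.
Variable n : nat.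
Implicit Types x : 'rV['F_2]_n.

Lemma hweightE x : hweight x = (\sum_i (x 0 i)%R)%N.
Proof.
rewrite /hweight -sum1_card big_mkcond /=; apply: eq_bigr => i _.
by rewrite inE [RHS]F2_val_neq0; case: (x 0 i != 0).
Qed.

Lemma hweight0 : hweight (0 : 'rV['F_2]_n) = 0%N.
Proof. by rewrite hweightE big1 // => i _; rewrite mxE. Qed.

Lemma hweight_eq0 x : (hweight x == 0%N) = (x == 0).
Proof.
apply/idP/eqP => [|->]; last by rewrite hweight0.
rewrite hweightE sum_nat_eq0 => /forallP x0; apply/rowP => i; rewrite mxE.
by apply/val_inj/eqP; exact: x0.
Qed.

Lemma hweight_del x i : x 0 i != 0 -> hweight x = (hweight (x + 'e_i)).+1.
Proof.
move=> xi; rewrite !hweightE (bigD1 i) //= [in RHS](bigD1 i) //= !mxE !eqxx /=.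
rewrite (F2_neq0_eq1 xi); congr S; apply: eq_bigr => j /negPf ji.
by rewrite !mxE ji andbF addr0.
Qed.

Lemma hweight_compl x : hweight (x + ones) = (n - hweight x)%N.
Proof.
suff : (hweight (x + ones) + hweight x)%N = n by lia.
rewrite !hweightE -big_split /= -[RHS]card_ord -sum1_card; apply: eq_bigr => i _.
by rewrite !mxE; case: (x 0 i) => [[|[|//]] ?].
Qed.

Lemma hweight_col_perm s x : hweight (col_perm s x) = hweight x.
Proof.
by rewrite !hweightE [RHS](reindex_perm s); apply: eq_bigr => i _; rewrite mxE.
Qed.

Definition slice w : {set 'rV['F_2]_n} := [set x | hweight x == w].

Lemma card_slice w : #|slice w| = 'C(n, w).
Proof.
pose supp x := [set i | x 0 i != 0].
pose row_of (B : {set 'I_n}) : 'rV['F_2]_n := \row_i (i \in B)%:R.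
have row_ofK : cancel row_of supp.
  by move=> B; apply/setP => i; rewrite inE mxE; case: (i \in B).
have suppK : cancel supp row_of.
  move=> x; apply/rowP => i; rewrite mxE inE.
  by have [->|/F2_neq0_eq1 ->] := eqVneq (x 0 i) 0.
rewrite -[X in 'C(X, _)]card_ord -card_draws -(card_imset _ (can_inj suppK)).
apply: eq_card => B; rewrite inE; apply/imsetP/idP => [[x]|BE].
  by rewrite inE => xw ->; rewrite cardsE.
by exists (row_of B); rewrite ?row_ofK // inE -[hweight _]cardsE -/(supp _) row_ofK.
Qed.

End HammingWeight.

Section Walsh.
Variables (R : realFieldType) (n : nat).
Local Notation V := 'rV['F_2]_n.
Implicit Types u v x y : V.

Lemma dotvC x u : dotv x u = dotv u x.
Proof. by apply: eq_bigr => i _; rewrite mulrC. Qed.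

Lemma dotvDl x y u : dotv (x + y) u = dotv x u + dotv y u.
Proof. by rewrite /dotv -big_split; apply: eq_bigr => i _; rewrite mxE mulrDl. Qed.

Lemma dotv_delta x i : dotv x 'e_i = x 0 i.
Proof.
rewrite /dotv (bigD1 i) //= mxE !eqxx mulr1 big1 ?addr0 // => j /negPf ji.
by rewrite mxE ji andbF mulr0.
Qed.

Lemma dotv_ones x : dotv x ones = (hweight x)%:R.
Proof. by rewrite hweightE natr_sum; apply: eq_bigr => i _; rewrite mxE mulr1 natr_Zp. Qed.

Lemma dotv_col_perm s x u : dotv (col_perm s x) (col_perm s u) = dotv x u.
Proof.
by rewrite /dotv [RHS](reindex_perm s); apply: eq_bigr => i _; rewrite !mxE.
Qed.

Definition walsh u x : R := F2_sign R (dotv x u).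

Lemma walshC u x : walsh u x = walsh x u.
Proof. by rewrite /walsh dotvC. Qed.

Lemma walshDr u x y : walsh u (x + y) = walsh u x * walsh u y.
Proof. by rewrite /walsh dotvDl F2_signD. Qed.

Lemma walshDl u v x : walsh (u + v) x = walsh u x * walsh v x.
Proof. by rewrite ![walsh _ x]walshC walshDr. Qed.

Lemma walsh0r u : walsh u 0 = 1.
Proof. by rewrite /walsh /dotv big1 // => i _; rewrite mxE mul0r. Qed.

Lemma walsh_delta i x : walsh 'e_i x = F2_sign R (x 0 i).
Proof. by rewrite /walsh dotv_delta. Qed.

Lemma walsh_ones x : walsh ones x = (-1) ^+ hweight x.
Proof. by rewrite /walsh dotv_ones F2_sign_nat. Qed.

Lemma sum_walsh x : \sum_u walsh u x = 2 ^+ n * (x == 0)%:R.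
Proof.
have [->|/rV0Pn[i /F2_neq0_eq1 xi]] := eqVneq x 0.
  under eq_bigr do rewrite walsh0r.
  by rewrite sumr_const card_mx card_Fp // mul1n natrX mulr1.
have : \sum_u walsh u x = - \sum_u walsh u x.
  rewrite {1}(reindex_inj (addIr 'e_i)) -sumrN; apply: eq_bigr => u _.
  by rewrite walshDl walsh_delta xi F2_sign1 mulrN1.
by rewrite mulr0; lra.
Qed.

Lemma sum_walsh_delta x : \sum_i walsh 'e_i x = n%:R - 2 * (hweight x)%:R.
Proof.
rewrite hweightE natr_sum mulr_sumr -[n in n%:R]card_ord -sumr_const -sumrB.
by apply: eq_bigr => i _; rewrite walsh_delta /F2_sign; case: (x 0 i) => [[|[|//]] ?] /=; ring.
Qed.

Section Coefficients.
Variable A : {set V}.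
Implicit Types F : V -> R.

Definition walsh_coef F u : R := mean A (fun x => F x * walsh u x).

Definition walsh_mean u : R := walsh_coef (fun=> 1) u.

Lemma walsh_meanE u : walsh_mean u = mean A (walsh u).
Proof. by apply: eq_mean => x _; rewrite mul1r. Qed.

Lemma walsh_inversion F x :
  \sum_u walsh_coef F u * walsh u x = 2 ^+ n / #|A|%:R * ((x \in A)%:R * F x).
Proof.
transitivity (mean A (fun y => 2 ^+ n * (F y * (y == x)%:R))).
  under eq_bigr => u _ do rewrite mulrC -meanZ.
  rewrite sum_mean; apply: eq_mean => y _.
  under eq_bigr => u _ do rewrite mulrCA -walshDr addrC.
  by rewrite -mulr_sumr sum_walsh F2_row_add_eq0 mulrCA.
rewrite meanZ -mulrA; congr (_ * _); rewrite mulrC; congr (_ / _).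
have [xA|xA] := boolP (x \in A); last first.
  rewrite mul0r big1 // => y yA; case: eqP => [yx|]; last by rewrite mulr0.
  by rewrite -yx yA in xA.
rewrite (bigD1 x) //= eqxx mulrC big1 ?addr0 // => y /andP[_ /negPf ->].
by rewrite mulr0.
Qed.

Lemma parseval F :
  \sum_u walsh_coef F u ^+ 2 = 2 ^+ n / #|A|%:R * mean A (fun x => F x ^+ 2).
Proof.
transitivity (mean A (fun x => F x * \sum_u walsh_coef F u * walsh u x)).
  under eq_bigr => u _ do rewrite expr2 [X in _ * X]/walsh_coef -meanZ.
  rewrite sum_mean; apply: eq_mean => x _; rewrite mulr_sumr.
  by apply: eq_bigr => u _; rewrite mulrCA.
rewrite -meanZ; apply: eq_mean => x xA.
by rewrite walsh_inversion xA mul1r mulrCA -expr2.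
Qed.

Definition additive_pair : pred (V * V) :=
  fun p => [&& p.1 \in A, p.2 \in A & p.1 + p.2 \in A].

Definition additivity_bias F : R :=
  mean additive_pair (fun p => F (p.1 + p.2) * (F p.1 * F p.2)).

Lemma sqr_walsh_coef F u : walsh_coef F u ^+ 2 =
  mean A (fun x => mean A (fun y => F x * F y * walsh u (x + y))).
Proof.
rewrite expr2 -meanZ; apply: eq_mean => x _; rewrite mulrC -meanZ.
by apply: eq_mean => y _; rewrite walshDr; ring.
Qed.

Lemma sum_walsh_coef_cube F :
  \sum_u walsh_coef F u ^+ 3 = 2 ^+ n / #|A|%:R ^+ 3 *
    \sum_(p | additive_pair p) F (p.1 + p.2) * (F p.1 * F p.2).
Proof.
transitivity (mean A (fun x => mean A (fun y =>
    F x * F y * \sum_u walsh_coef F u * walsh u (x + y)))).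
  under eq_bigr => u _ do rewrite exprS sqr_walsh_coef -meanZ.
  rewrite sum_mean; apply: eq_mean => x _.
  under eq_bigr => u _ do rewrite -meanZ.
  rewrite sum_mean; apply: eq_mean => y _; rewrite mulr_sumr.
  by apply: eq_bigr => u _; ring.
rewrite -(pair_big_dep [in A] (fun x y => (y \in A) && (x + y \in A))
            (fun x y => F (x + y) * (F x * F y))) /=.
rewrite /mean !mulr_suml mulr_sumr; apply: eq_bigr => x _.
rewrite big_mkcondr /= !mulr_suml mulr_sumr; apply: eq_bigr => y _.
rewrite walsh_inversion -exprVn.
by case: (x + y \in A); rewrite ?mul1r ?mul0r ?mulr0 ?mul0r //; ring.
Qed.

Lemma sum_walsh_coef_cube_bias F :
  \sum_u walsh_coef F u ^+ 3 = (\sum_u walsh_mean u ^+ 3) * additivity_bias F.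
Proof.
rewrite !sum_walsh_coef_cube; under [X in _ = _ * X * _]eq_bigr do rewrite !mulr1.
by rewrite sumr_const -[RHS]mulrA card_mul_mean.
Qed.

Lemma normr_additivity_bias_le1 F : {in A, forall x, F x ^+ 2 = 1} -> `|additivity_bias F| <= 1.
Proof.
move=> F1; apply: normr_mean_le1 => p /and3P[p1A p2A p12A].
by rewrite le_eqVlt -sqr_norm_eq1 !exprMn !F1 ?mul1r ?eqxx.
Qed.

Lemma normr_walsh_coef_le1 F u : {in A, forall x, F x ^+ 2 = 1} -> `|walsh_coef F u| <= 1.
Proof.
move=> F1; apply: normr_mean_le1 => x xA.
by rewrite le_eqVlt -sqr_norm_eq1 exprMn F1 // F2_sign_sqr mulr1 eqxx.
Qed.

(* Cauchy-Schwarz on A for the pairing of F with sum_u c_u chi_u. *)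
Lemma sqr_sum_walsh_coef_le F (c : V -> R) : {in A, forall x, F x ^+ 2 = 1} ->
  (\sum_u c u * walsh_coef F u) ^+ 2 <= \sum_u \sum_v c u * c v * walsh_mean (u + v).
Proof.
move=> F1; pose h x := \sum_u c u * walsh u x.
have -> : \sum_u c u * walsh_coef F u = mean A (fun x => F x * h x).
  under eq_bigr => u _ do rewrite -meanZ.
  rewrite sum_mean; apply: eq_mean => x _; rewrite mulr_sumr.
  by apply: eq_bigr => u _; rewrite mulrCA.
have -> : \sum_u \sum_v c u * c v * walsh_mean (u + v) = mean A (fun x => (F x * h x) ^+ 2).
  under eq_bigr => u _ do under eq_bigr => v _ do rewrite walsh_meanE -meanZ.
  under eq_bigr => u _ do rewrite sum_mean.
  rewrite sum_mean; apply: eq_mean => x xA; rewrite exprMn F1 // mul1r expr2 mulr_suml.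
  apply: eq_bigr => u _; rewrite mulr_sumr.
  by apply: eq_bigr => v _; rewrite walshDl; ring.
exact: sqr_mean_le.
Qed.

Lemma walsh_mean_translate a u : (forall x, (x + a \in A) = (x \in A)) ->
  walsh_mean u = walsh u a * walsh_mean u.
Proof.
move=> Aa; rewrite !walsh_meanE -meanZ; congr (_ / _).
rewrite (reindex_inj (addIr a)) /=; apply: eq_big => [x|x _]; first exact: Aa.
by rewrite walshDr mulrC.
Qed.

Lemma walsh_mean_col_perm s u : (forall x, (col_perm s x \in A) = (x \in A)) ->
  walsh_mean (col_perm s u) = walsh_mean u.
Proof.
move=> As; rewrite !walsh_meanE; congr (_ / _).
have col_perm_inj : injective (col_perm s : V -> V).
  by apply: (can_inj (g := col_perm s^-1)) => x; rewrite -col_permM mulVg col_perm1.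
rewrite (reindex_inj col_perm_inj) /=; apply: eq_big => [x|x _]; first exact: As.
by rewrite /walsh dotv_col_perm.
Qed.

Definition annihilator : {set V} := [set u | [forall x in A, dotv x u == 0]].

Lemma walsh_annihilator u x : u \in annihilator -> x \in A -> walsh u x = 1.
Proof. by rewrite inE => /forall_inP uA /uA/eqP xu0; rewrite /walsh xu0. Qed.

Lemma annihilator0 : 0 \in annihilator.
Proof.
by rewrite inE; apply/forall_inP => x _; rewrite /dotv big1 // => i _; rewrite mxE mulr0.
Qed.

Lemma walsh_coef_annihilator F u w :
  w \in annihilator -> walsh_coef F (u + w) = walsh_coef F u.
Proof.
by move=> wA; apply: eq_mean => x xA; rewrite walshDl (walsh_annihilator wA) // mulr1.
Qed.

End Coefficients.
End Walsh.

Section LinearityTest.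
Variables (R : realFieldType) (n : nat) (A : {set 'rV['F_2]_n}).
Local Notation V := 'rV['F_2]_n.
Local Notation W := (annihilator A).
Local Notation mu := (@walsh_mean R n A).
Local Notation hat := (@walsh_coef R n A).
Local Notation K := (2 ^+ n / #|A|%:R : R).
Hypothesis A_gt0 : (0 < #|A|)%N.

Lemma walsh_mean_annihilator w : w \in W -> mu w = 1.
Proof.
move=> wW; rewrite walsh_meanE -[RHS](mean_cst 1 A_gt0).
by apply: eq_mean => x; exact: walsh_annihilator.
Qed.

Lemma parseval_sign F : {in A, forall x, F x ^+ 2 = 1} -> \sum_u hat F u ^+ 2 = K.
Proof. by move=> F1; rewrite parseval (eq_mean F1) mean_cst ?mulr1. Qed.

Lemma sum_annihilator_coset (g : V -> R) u : (forall v w, w \in W -> g (v + w) = g v) ->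
  \sum_v g v * (u + v \in W)%:R = #|W|%:R * g u.
Proof.
move=> gW; rewrite (reindex_inj (addrI u)) /=.
under eq_bigr => v _ do rewrite addrA F2_row_addrr add0r mulr_natr mulrb.
by rewrite -big_mkcond /= (eq_bigr (fun=> g u)) ?sumr_const ?mulr_natl // => w /gW.
Qed.

Lemma walsh_mean_quad_form_le (e : R) (g : V -> R) :
  0 <= e -> (forall u, u \notin W -> mu u <= e) ->
  (forall u, 0 <= g u) -> (forall v w, w \in W -> g (v + w) = g v) ->
  \sum_u \sum_v g u * g v * mu (u + v) <=
    #|W|%:R * \sum_u g u ^+ 2 + e * (\sum_u g u) ^+ 2.
Proof.
move=> e0 mu_le g0 gW; rewrite expr2 mulr_suml !mulr_sumr -big_split /=.
apply: ler_sum => u _.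
apply: le_trans (_ : \sum_v g u * (g v * (u + v \in W)%:R + g v * e) <= _).
  apply: ler_sum => v _; rewrite -mulrA ler_wpM2l // -mulrDr ler_wpM2l //.
  have [/walsh_mean_annihilator ->|/mu_le] := boolP (u + v \in W); first by rewrite lerDl.
  by rewrite add0r.
rewrite -mulr_sumr big_split /= sum_annihilator_coset // -mulr_suml.
lra.
Qed.

Lemma sum_walsh_mean_cube_ge (b : R) : 0 <= b -> (forall u, u \notin W -> `|mu u| <= b) ->
  #|W|%:R - b * K <= \sum_u mu u ^+ 3.
Proof.
move=> b0 mu_le; have <- : \sum_u mu u ^+ 2 = K.
  by apply: parseval_sign => x _; rewrite expr1n.
rewrite -sum1_card natr_sum big_mkcond mulr_sumr -sumrB; apply: ler_sum => u _ /=.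
rewrite lerBlDr; have mu2 := sqr_ge0 (mu u).
case: ifPn => [/walsh_mean_annihilator ->|/mu_le]; first by rewrite !expr1n lerDl mulr1.
rewrite ler_norml => /andP[mu_ge _].
by rewrite exprSr mulrC -mulrDl mulr_ge0 // -lerBlDr sub0r.
Qed.

Section Sign.
Variable F : V -> R.
Hypothesis F1 : {in A, forall x, F x ^+ 2 = 1}.

Local Notation pos u := (Num.max 0 (hat F u)).

Lemma sqr_sum_pos_cube_le (M e : R) :
  (forall u, hat F u <= M) -> 0 <= e -> (forall u, u \notin W -> mu u <= e) ->
  (\sum_u pos u ^+ 3) ^+ 2 <= #|W|%:R * M * \sum_u pos u ^+ 3 + e * K ^+ 2.
Proof.
move=> hat_le e0 mu_le.
have pos0 u : 0 <= pos u by rewrite le_max lexx.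
have posW v w : w \in W -> pos (v + w) ^+ 2 = pos v ^+ 2.
  by move=> wW; rewrite walsh_coef_annihilator.
have posM u : pos u * hat F u = pos u ^+ 2.
  by rewrite expr2; case: (leP 0 (hat F u)) => // _; rewrite !mul0r.
have {1}-> : \sum_u pos u ^+ 3 = \sum_u pos u ^+ 2 * hat F u.
  by apply: eq_bigr => u _; rewrite [in RHS]expr2 -mulrA posM -exprS.
apply: le_trans (sqr_sum_walsh_coef_le _ F1) _.
apply: le_trans (walsh_mean_quad_form_le e0 mu_le _ posW) _ => [u|]; first exact: sqr_ge0.
rewrite -mulrA lerD // ler_wpM2l //.
  rewrite mulr_sumr; apply: ler_sum => u _; rewrite -exprM (exprSr _ 3) mulrC.
  case: (leP 0 (hat F u)) => [|_]; last by rewrite expr0n /= !mulr0.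
  by move=> hat_ge0; rewrite ler_wpM2r ?exprn_ge0 ?hat_le.
rewrite -(parseval_sign F1) ler_sqr ?nnegrE ?sumr_ge0 // => [|u _|u _]; try exact: sqr_ge0.
apply: ler_sum => u _.
by case: (leP 0 (hat F u)) => // _; rewrite expr0n sqr_ge0.
Qed.

Lemma sum_pos_cube_le (M r : R) : 0 <= M -> (forall u, hat F u <= M) ->
  0 <= r -> (forall u, u \notin W -> mu u <= r ^+ 2) ->
  \sum_u pos u ^+ 3 <= #|W|%:R * M + r * K.
Proof.
move=> M0 hat_le r0 mu_le; have := sqr_sum_pos_cube_le hat_le (sqr_ge0 r) mu_le.
rewrite -exprMn; have : 0 <= r * K by rewrite mulr_ge0 // divr_ge0 ?exprn_ge0.
have : 0 <= #|W|%:R * M by rewrite mulr_ge0.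
move: (\sum_u _) (#|W|%:R * M) (r * K) => P a c a0 c0 P2_le.
by rewrite leNgt; apply/negP; nra.
Qed.

Lemma sum_cube_le_sum_pos_cube : \sum_u hat F u ^+ 3 <= \sum_u pos u ^+ 3.
Proof.
apply: ler_sum => u _; case: (leP 0 (hat F u)) => // hat_lt0.
by rewrite expr0n exprSr mulr_ge0_le0 ?sqr_ge0 // ltW.
Qed.

Lemma exists_walsh_coef_max : 0 \notin A ->
  exists2 u, 0 <= hat F u & forall v, hat F v <= hat F u.
Proof.
move=> A0; pose u := [arg max_(u > (0 : V)) hat F u]%O.
have hat_le v : hat F v <= hat F u by rewrite /u; case: arg_maxP => //= w _; apply.
exists u => //; rewrite leNgt; apply/negP => hat_u_lt0.
have hat_lt0 v : hat F v < 0 := le_lt_trans (hat_le v) hat_u_lt0.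
have : \sum_v - hat F v = 0.
  transitivity (- \sum_v hat F v * walsh R v 0); last first.
    by rewrite walsh_inversion (negPf A0) mul0r mulr0 oppr0.
  by rewrite sumrN; congr (- _); apply: eq_bigr => v _; rewrite walsh0r mulr1.
move/psumr_eq0P => hat0; have := hat_lt0 0.
by rewrite -oppr_gt0 hat0 ?ltxx // => v _; rewrite oppr_ge0 ltW.
Qed.

Lemma walsh_coef_ge_additivity_bias (b r : R) : 0 \notin A -> 0 <= b -> 0 <= r ->
  (forall u, u \notin W -> `|mu u| <= b) -> (forall u, u \notin W -> mu u <= r ^+ 2) ->
  exists u, additivity_bias A F - (b + r) * K <= hat F u.
Proof.
move=> A0 b0 r0 mu_le_b mu_le_r; have [u M0 hat_le] := exists_walsh_coef_max A0.
exists u; set delta := additivity_bias A F; move: (hat F u) M0 hat_le => M M0 hat_le.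
have error_ge0 : 0 <= (b + r) * K by rewrite mulr_ge0 ?addr_ge0 // divr_ge0 ?exprn_ge0.
have [delta_le0|delta_gt0] := leP delta 0; first by lra.
have P_le := sum_pos_cube_le M0 hat_le r0 mu_le_r.
have cube_le : (#|W|%:R - b * K) * delta <= \sum_u hat F u ^+ 3.
  by rewrite sum_walsh_coef_cube_bias ler_wpM2r ?(ltW delta_gt0) // sum_walsh_mean_cube_ge.
have bK_delta_le : b * K * delta <= b * K.
  have := normr_additivity_bias_le1 F1; rewrite (gtr0_norm delta_gt0) => delta_le1.
  by rewrite ler_piMr // mulr_ge0 // divr_ge0 ?exprn_ge0.
have gap_le : #|W|%:R * (delta - M) <= (b + r) * K.
  by have := sum_cube_le_sum_pos_cube; lra.
have W_ge1 : 1 <= #|W|%:R :> R by rewrite ler1n; apply/card_gt0P; exists 0; exact: annihilator0.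
rewrite lerBlDr -lerBlDl; have [gap_le0|gap_gt0] := leP (delta - M) 0.
  exact: le_trans gap_le0 error_ge0.
by apply: le_trans gap_le; rewrite ler_peMl // ltW.
Qed.

End Sign.
End LinearityTest.

Section SliceMean.
Variables (R : realFieldType) (n w : nat).
Local Notation V := 'rV['F_2]_n.
Local Notation mu := (walsh_mean R (slice n w)).
Implicit Types u : V.

Lemma slice_col_perm s x : (col_perm s x \in slice n w) = (x \in slice n w).
Proof. by rewrite !inE hweight_col_perm. Qed.

Lemma slice_mean_swap u i j : u 0 i = u 0 j -> mu (u + 'e_i) = mu (u + 'e_j).
Proof.
move=> uij; rewrite -(walsh_mean_col_perm _ _ (slice_col_perm (tperm i j))).
congr (walsh_mean _ _ _); apply/rowP => k; rewrite !mxE eqxx /=; congr (_ + _%:R).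
  by case: tpermP => [->|->|].
by congr nat_of_bool; rewrite -{2}(tpermR i j) (inj_eq perm_inj).
Qed.

Lemma sum_slice_mean_delta u : \sum_i mu (u + 'e_i) = (n%:R - 2 * w%:R) * mu u.
Proof.
under eq_bigr => i _ do rewrite walsh_meanE.
rewrite sum_mean walsh_meanE -meanZ; apply: eq_mean => x; rewrite inE => /eqP xw.
under eq_bigr => i _ do rewrite walshDl mulrC.
by rewrite -mulr_suml sum_walsh_delta xw.
Qed.

(* The three-term recurrence of the Krawtchouk polynomials. *)
Lemma slice_mean_recurrence u i j : u 0 i = 0 -> u 0 j != 0 ->
  (n%:R - (hweight u)%:R) * mu (u + 'e_i) + (hweight u)%:R * mu (u + 'e_j) =
  (n%:R - 2 * w%:R) * mu u.
Proof.
move=> ui0 /F2_neq0_eq1 uj1; rewrite -sum_slice_mean_delta hweightE natr_sum.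
rewrite -[n in n%:R]card_ord -sumr_const -sumrB !mulr_suml -big_split /=.
apply: eq_bigr => k _; have [uk|/F2_neq0_eq1 uk] := eqVneq (u 0 k) 0.
  by rewrite uk subr0 mul1r mul0r addr0 (@slice_mean_swap u k i) ?uk ?ui0.
by rewrite uk subrr mul0r add0r mul1r (@slice_mean_swap u k j) ?uk ?uj1.
Qed.

End SliceMean.

Lemma sqr_central_bin_ge k : (0 < k)%N ->
  ((4 ^ k) ^ 2 <= 4 * k * 'C(k.*2, k) ^ 2)%N.
Proof.
case: k => // k _; elim: k => // k IH.
have binS : (k.+2 * 'C(k.+2.*2, k.+2) = 2 * (k.+1.*2).+1 * 'C(k.+1.*2, k.+1))%N.
  have := mul_bin_diag (k.+1.*2).+2 k.+1; have := mul_bin_down (k.+1.*2).+1 k.+1.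
  by rewrite doubleS /= => bin_down <-; rewrite -mulnA bin_down; lia.
rewrite -(leq_pmul2l (ltn0Sn k.+1)).
have -> : (k.+2 * (4 * k.+2 * 'C(k.+2.*2, k.+2) ^ 2) = 4 * (k.+2 * 'C(k.+2.*2, k.+2)) ^ 2)%N.
  by ring.
rewrite binS [(4 ^ k.+2)%N]expnS; move: IH.
by move: 'C(k.+1.*2, k.+1) (4 ^ k.+1)%N => b p; nia.
Qed.

Lemma card_half_slice n : #|half_slice n| = 'C(n, n./2).
Proof. exact: card_slice. Qed.

Lemma half_slice_gt0 n : (0 < #|half_slice n|)%N.
Proof. by rewrite card_half_slice bin_gt0; lia. Qed.

Section HalfSlice.
Variables (R : realFieldType) (n : nat).
Hypotheses (n_dvd4 : (4 %| n)%N) (n_gt0 : (0 < n)%N).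
Local Notation V := 'rV['F_2]_n.
Local Notation T := (half_slice n).
Local Notation mu := (walsh_mean R T).
Local Notation beta := (3 / ((n%:R - 1) * (n%:R - 3))).
Implicit Types u v : V.

Lemma natr_dvd4_ge4 : 4 <= n%:R :> R.
Proof. by rewrite ler_nat; lia. Qed.

Lemma beta_ge0 : 0 <= beta :> R.
Proof. by have n_ge4 := natr_dvd4_ge4; rewrite divr_ge0 // mulr_ge0 //; lra. Qed.

Lemma sqr_half_slice_inv_density_le : (2 ^+ n / #|T|%:R) ^+ 2 <= 2 * n%:R :> R.
Proof.
have [n2 n2_gt0] : (n./2.*2 = n /\ 0 < n./2)%N by lia.
rewrite expr_div_n ler_pdivrMr ?exprn_gt0 ?ltr0n ?half_slice_gt0 //.
rewrite card_half_slice -!natrX -!natrM ler_nat.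
have := sqr_central_bin_ge n2_gt0; rewrite n2 -(expnM 2 2) mul2n n2.
suff -> : (4 * n./2 = 2 * n)%N by [].
by lia.
Qed.

Lemma zero_notin_half_slice : (0 : V) \notin T.
Proof. by rewrite inE hweight0; lia. Qed.

Lemma annihilator_half_slice_ones : ones \in annihilator T.
Proof.
rewrite inE; apply/forall_inP => x; rewrite inE => /eqP xT.
by rewrite dotv_ones -(dvdn_pcharf (pchar_Fp _)) // xT; lia.
Qed.

Lemma half_slice_mean_odd u : odd (hweight u) -> mu u = 0.
Proof.
move=> u_odd; have : mu u = walsh R u ones * mu u.
  by apply: walsh_mean_translate => x; rewrite !inE hweight_compl; lia.
by rewrite walshC walsh_ones -signr_odd u_odd; lra.
Qed.

Lemma half_slice_mean0 : mu 0 = 1.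
Proof. exact: walsh_mean_annihilator (half_slice_gt0 n) _ (annihilator0 _). Qed.

Lemma half_slice_mean_recurrence v : (1 < hweight v)%N ->
  exists2 u, hweight v = (hweight u).+2 &
    (n%:R - (hweight u).+1%:R) * mu v = - (hweight u).+1%:R * mu u.
Proof.
move=> v_gt1; have [i vi] : exists i, v 0 i != 0.
  by apply/rV0Pn; rewrite -hweight_eq0; lia.
have v_i := hweight_del vi; have [j vj] : exists j, (v + 'e_i) 0 j != 0.
  by apply/rV0Pn; rewrite -hweight_eq0; lia.
have v_ij := hweight_del vj; exists (v + 'e_i + 'e_j); first by rewrite v_i v_ij.
have vi0 : (v + 'e_i) 0 i = 0 by rewrite !mxE !eqxx (F2_neq0_eq1 vi) addrr_pchar2 ?pchar_Fp.
have := slice_mean_recurrence R n./2 vi0 vj; rewrite F2_row_addrK -v_ij.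
have -> : n%:R = 2 * n./2%:R :> R by rewrite -natrM; congr _%:R; lia.
by rewrite subrr mul0r mulNr => /eqP; rewrite addr_eq0 => /eqP.
Qed.

Lemma half_slice_mean_weight2 v : hweight v = 2%N -> mu v = - (n%:R - 1)^-1.
Proof.
move=> v2; have n_ge4 := natr_dvd4_ge4.
have [|u] := @half_slice_mean_recurrence v; first by rewrite v2.
rewrite v2 => -[/esym/eqP]; rewrite hweight_eq0 => /eqP ->; rewrite hweight0 half_slice_mean0.
by rewrite mulr1 => /(canRL (mulKf _)) ->; [field|]; apply/lt0r_neq0; lra.
Qed.

Lemma half_slice_mean_weight4 v : hweight v = 4%N -> mu v = beta.
Proof.
move=> v4; have n_ge4 := natr_dvd4_ge4.
have [|u] := @half_slice_mean_recurrence v; first by rewrite v4.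
rewrite v4 => -[/esym u2]; rewrite (half_slice_mean_weight2 u2) u2.
have n1 : n%:R - 1 != 0 :> R by apply/lt0r_neq0; lra.
have n3 : n%:R - 3 != 0 :> R by apply/lt0r_neq0; lra.
by move=> /(canRL (mulKf n3)) ->; field; apply/andP.
Qed.

Lemma normr_half_slice_mean_le v : (2 < hweight v <= n./2)%N -> `|mu v| <= beta.
Proof.
have n_ge4 := natr_dvd4_ge4.
have [k] := ubnP (hweight v); elim: k v => // k IH v v_lt /andP[v_gt2 v_le].
have [v4|v_neq4] := eqVneq (hweight v) 4.
  by rewrite half_slice_mean_weight4 // ger0_norm // beta_ge0.
have [v3|v_neq3] := eqVneq (hweight v) 3.
  by rewrite half_slice_mean_odd ?v3 // normr0 beta_ge0.
have [|u vu muE] := @half_slice_mean_recurrence v; first exact: ltnW.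
apply: le_trans (IH u _ _); [|by lia|by lia].
have gap : 2 * (hweight u).+1%:R <= n%:R :> R by rewrite -natrM ler_nat; lia.
have u_gt0 : 0 < (hweight u).+1%:R :> R by rewrite ltr0n.
have c_gt0 : 0 < n%:R - (hweight u).+1%:R :> R by lra.
rewrite -(ler_pM2l c_gt0) -{1}(gtr0_norm c_gt0) -normrM muE mulNr normrN normrM.
by rewrite ler_wpM2r // gtr0_norm //; lra.
Qed.

Lemma half_slice_mean_bounds u : u != 0 -> u != ones ->
  mu u <= beta /\ `|mu u| <= (n%:R - 1)^-1.
Proof.
have n_ge4 := natr_dvd4_ge4.
wlog u_le : u / (hweight u <= n./2)%N => [bounds|] u0 u1.
  have [/bounds|u_gt] := leqP (hweight u) n./2; first exact.
  rewrite /walsh_mean -(walsh_coef_annihilator _ _ annihilator_half_slice_ones).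
  apply: bounds; first by rewrite hweight_compl; lia.
    by rewrite F2_row_add_eq0.
  by rewrite -subr_eq0 addrK.
have inv_ge0 : 0 <= (n%:R - 1)^-1 :> R by rewrite invr_ge0; lra.
have [u_gt2|] := ltnP 2 (hweight u).
  have mu_le : `|mu u| <= beta by apply: normr_half_slice_mean_le; rewrite u_gt2.
  split; first exact: le_trans (ler_norm _) mu_le.
  apply: le_trans mu_le _; have n_ge6 : 6 <= n%:R :> R by rewrite ler_nat; lia.
  by rewrite invfM mulrCA ger_pMr ?invr_gt0 ?ler_pdivrMr; lra.
rewrite leq_eqVlt => /predU1P[/half_slice_mean_weight2 ->|u_lt2].
  split; last by rewrite normrN ger0_norm.
  by apply: le_trans beta_ge0; rewrite oppr_le0.
have u_odd : odd (hweight u) by have := hweight_eq0 u; rewrite (negPf u0); lia.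
by rewrite half_slice_mean_odd // normr0 beta_ge0.
Qed.

Lemma walsh_coef_ge_half_slice_bias (F : V -> R) : {in T, forall x, F x ^+ 2 = 1} ->
  exists u, additivity_bias T F - 4 / (n%:R - 1) * (2 ^+ n / #|T|%:R) <= walsh_coef T F u.
Proof.
move=> F1; have n_ge4 := natr_dvd4_ge4.
have bounds u : u \notin annihilator T ->
    mu u <= beta /\ `|mu u| <= (n%:R - 1)^-1.
  move=> uW; apply: half_slice_mean_bounds; apply: contraNneq uW => ->.
    exact: annihilator0.
  exact: annihilator_half_slice_ones.
have -> : 4 / (n%:R - 1) = (n%:R - 1)^-1 + 3 / (n%:R - 1) :> R.
  by field; apply/lt0r_neq0; lra.
apply: (walsh_coef_ge_additivity_bias (half_slice_gt0 n) F1 zero_notin_half_slice).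
- by rewrite invr_ge0; lra.
- by rewrite divr_ge0; lra.
- by move=> u /bounds[].
move=> u /bounds[mu_le _]; apply: le_trans mu_le _.
have n1_gt0 : 0 < n%:R - 1 :> R by lra.
have n3_gt0 : 0 < n%:R - 3 :> R by lra.
rewrite expr_div_n ler_pdivrMr ?mulr_gt0 // mulrAC ler_pdivlMr ?exprn_gt0 //.
nra.
Qed.

End HalfSlice.

Section Asymptotics.
Variable R : realType.

Lemma cvg_sqrt_harmonic : Num.sqrt (harmonic n : R) @[n --> \oo] --> (0 : R).
Proof.
rewrite -[X in _ --> X]sqrtr0.
apply: (@continuous_cvg _ _ _ \oo _ (@harmonic R) (@Num.sqrt R) 0).
  exact: sqrt_continuous.
exact: cvg_harmonic.
Qed.

Lemma half_slice_error_le n : (4 %| n)%N -> (0 < n)%N ->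
  4 / (n%:R - 1) * (2 ^+ n / #|half_slice n|%:R) <= 10 * Num.sqrt (harmonic n : R).
Proof.
move=> n_dvd4 n_gt0; have n_ge4 := natr_dvd4_ge4 R n_dvd4 n_gt0.
have n1_gt0 : 0 < n%:R - 1 :> R by lra.
have nS_gt0 : 0 < n%:R + 1 :> R by lra.
have := sqr_half_slice_inv_density_le R n_dvd4 n_gt0; set k := 2 ^+ n / _ => k2_le.
have k_ge0 : 0 <= k by rewrite divr_ge0 ?exprn_ge0.
have lhs_ge0 : 0 <= 4 / (n%:R - 1) * k by rewrite mulr_ge0 // divr_ge0 // ltW.
rewrite -ler_sqr ?nnegrE ?lhs_ge0 // ?mulr_ge0 ?sqrtr_ge0 //.
rewrite exprMn expr_div_n [(10 * _) ^+ 2]exprMn sqr_sqrtr ?invr_ge0 // /harmonic /= -natr1.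
rewrite mulrAC ler_pdivrMr ?exprn_gt0 // [leRHS]mulrAC ler_pdivlMr //.
have : k ^+ 2 * (n%:R + 1) <= 2 * n%:R * (n%:R + 1) by rewrite ler_pM2r.
nra.
Qed.

Lemma half_slice_linearity_test n (F : 'rV['F_2]_n -> R) :
    (4 %| n)%N -> {in half_slice n, forall x, F x ^+ 2 = 1} ->
  exists u, additivity_bias (half_slice n) F - 10 * Num.sqrt (harmonic n) <=
    walsh_coef (half_slice n) F u.
Proof.
move=> n_dvd4 F1; have [n0|n_gt0] := posnP n.
  exists 0; have -> : Num.sqrt (harmonic n) = 1 :> R by rewrite n0 /harmonic /= invr1 sqrtr1.
  have /ler_normlP[_ bias_le1] := normr_additivity_bias_le1 F1.
  have /ler_normlP[coef_ge _] := normr_walsh_coef_le1 0 F1.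
  by lra.
have [u coef_ge] := walsh_coef_ge_half_slice_bias n_dvd4 n_gt0 F1.
by exists u; have := half_slice_error_le n_dvd4 n_gt0; lra.
Qed.

End Asymptotics.

(* f is given on all of F_2^n; only its values on the half slice occur. *)
Theorem theorem1p1 (R : realType) :
  exists eps : nat -> R,
    (eps n @[n --> \oo] --> (0 : R)) /\
    forall n : nat, (4 %| n)%N ->
    forall (f : 'rV['F_2]_n -> 'F_2) (delta : R),
      ucprob R
        (fun p : 'rV['F_2]_n * 'rV['F_2]_n => f (p.1 + p.2) == f p.1 + f p.2)
        (fun p => [&& p.1 \in half_slice n, p.2 \in half_slice n
                    & p.1 + p.2 \in half_slice n])
      = (1 + delta) / 2 ->
      exists u : 'rV['F_2]_n,
        ucprob R (fun x => f x == dotv x u) (fun x => x \in half_slice n)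
        >= (1 + delta) / 2 - eps n.
Proof.
exists (fun n => 5 * Num.sqrt (harmonic n)); split.
  by rewrite -[X in _ --> X](mulr0 5); apply: cvgMl_tmp; exact: cvg_sqrt_harmonic.
move=> n n_dvd4 f delta probE; pose F x := F2_sign R (f x).
have delta_le : delta <= additivity_bias (half_slice n) F.
  move: probE; rewrite ucprob_F2_eq.
  have -> : additivity_bias (half_slice n) F = mean (additive_pair (half_slice n))
      (fun p => F2_sign R (f (p.1 + p.2)) * F2_sign R (f p.1 + f p.2)).
    by apply: eq_mean => p _; rewrite F2_signD.
  by case: (0 < _)%N => /=; lra.
have [u coef_ge] := half_slice_linearity_test n_dvd4 (fun x _ => F2_sign_sqr R (f x)).
exists u; rewrite ucprob_F2_eq half_slice_gt0 -[mean _ _]/(walsh_coef (half_slice n) F u).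
by move: coef_ge; rewrite -/F /=; lra.
Qed.
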